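(* Let $p\ge2$ be an integer, $r\in\{0,\dots,p-1\}$, $f:\mathbb{Z}_p\to\mathbb{Z}_p$ a function, $g,h\in\mathbb{Z}_p[x]$ such that $\gcd(p,h(r)\,\%\,p)=1$ and $f(n)=g(n)/h(n)$ for all $n\in r+p\mathbb{Z}_p$, and $k\ge0$ an integer. Then: (1) $f$ is weakly $(p,r)$-suitable at $k$. (2) If $k\le1$, then $f$ is $(p,r)$-suitable at $k$. (3) If $k\ge2$, then $f$ is $(p,r)$-suitable at $k$ if and only if the polynomial $g-(f(r)\,\%\,p)\,h$ is $(p,r)$-suitable at $k$.
   Context: $p\ge2$ is an integer, not necessarily prime. $\mathbb{Z}_p=\varprojlim \mathbb{Z}/p^k\mathbb{Z}$; every $a\in\mathbb{Z}_p$ is uniquely $a=\sum_{i\ge0}a_ip^i$ with $a_i\in\{0,\dots,p-1\}$, and $a\,\%\,p:=a_0$. A function $f:\mathbb{Z}_p\to\mathbb{Z}_p$ is weakly $(p,r)$-suitable at $k$ if for all $m,n\in r+p\mathbb{Z}_p$: $m\equiv n\pmod{p^k}$ implies $f(m)-(f(m)\%p)\equiv f(n)-(f(n)\%p)\pmod{p^k}$; it is $(p,r)$-suitable at $k$ if this implication is an equivalence for all $m,n\in r+p\mathbb{Z}_p$. Polynomials in $\mathbb{Z}_p[x]$ are regarded as functions $\mathbb{Z}_p\to\mathbb{Z}_p$. *)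

(* Defs.v *)
From HB Require Import structures.
From mathcomp Require Import all_boot all_order all_algebra.
From mathcomp Require Import boolp.

Set Implicit Arguments.
Unset Strict Implicit.
Unset Printing Implicit Defensive.

Import GRing.Theory.
Local Open Scope ring_scope.

(* The index is shifted: component k lives in Z/p^(k+1), since 'Z_(p ^ 0)
   would be Z/2 and not the trivial ring (which the limit can do without).
   For p < 2 this type is isomorphic to Z/2, so that the ring structures below
   need no hypothesis on p; it is the ring of p-adic integers when 1 < p. *)
Record padic (p : nat) := Padic {
  padic_val : forall k, 'Z_(p ^ k.+1);
  padic_compat : forall k, (padic_val k.+1)%:R = padic_val k }.

Lemma padicP p (a b : padic p) :
  (forall k, padic_val a k = padic_val b k) <-> a = b.
Proof.
split=> [|-> //]; case: a b => [a ca] [b cb] /= eq_ab.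
have eab : a = b by apply: functional_extensionality_dep.
by subst b; congr Padic; apply: Prop_irrelevance.
Qed.

HB.instance Definition _ p := gen_eqMixin (padic p).
HB.instance Definition _ p := gen_choiceMixin (padic p).

Fact expn_gt1 p k : (1 < p)%N -> (1 < p ^ k.+1)%N.
Proof. by move=> p_gt1; have := ltn_exp2r 1 p (ltn0Sn k); rewrite exp1n p_gt1. Qed.

Section PadicRing.
Variable p : nat.

Definition padic_red k (x : 'Z_(p ^ k.+2)) : 'Z_(p ^ k.+1) := x%:R.

Lemma padic_redE k n : padic_red (n%:R : 'Z_(p ^ k.+2)) = n%:R.
Proof.
have dvd_pk : ((Zp_trunc (p ^ k.+1)).+2 %| (Zp_trunc (p ^ k.+2)).+2)%N.
  have [p_gt1|] := ltnP 1 p; last first.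
    by case: p => [|[|[]]] //= _; rewrite ?exp0n ?exp1n.
  by rewrite !Zp_cast ?expn_gt1 // dvdn_exp2l.
apply: val_inj; rewrite /padic_red [n%:R]Zp_nat /= !Zp_nat /=.
by rewrite modn_dvdm.
Qed.

Lemma padic_redD k : {morph @padic_red k : x y / x + y}.
Proof.
by move=> x y; rewrite -[x]natr_Zp -[y]natr_Zp -natrD !padic_redE natrD.
Qed.

Lemma padic_redM k : {morph @padic_red k : x y / x * y}.
Proof.
by move=> x y; rewrite -[x]natr_Zp -[y]natr_Zp -natrM !padic_redE natrM.
Qed.

Lemma padic_redN k : {morph @padic_red k : x / - x}.
Proof.
move=> x; apply/eqP; rewrite -addr_eq0 -padic_redD addNr.
by rewrite -[0]/(0%:R) padic_redE.
Qed.

Definition padic_zero := Padic (fun k => padic_redE k 0).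
Definition padic_one := Padic (fun k => padic_redE k 1).

Fact padic_opp_subproof (a : padic p) k :
  padic_red (- padic_val a k.+1) = - padic_val a k.
Proof. by rewrite padic_redN; congr (- _); apply: padic_compat. Qed.
Definition padic_opp a := Padic (padic_opp_subproof a).

Fact padic_add_subproof (a b : padic p) k :
  padic_red (padic_val a k.+1 + padic_val b k.+1) =
  padic_val a k + padic_val b k.
Proof. by rewrite padic_redD; congr (_ + _); apply: padic_compat. Qed.
Definition padic_add a b := Padic (padic_add_subproof a b).

Fact padic_mul_subproof (a b : padic p) k :
  padic_red (padic_val a k.+1 * padic_val b k.+1) =
  padic_val a k * padic_val b k.
Proof. by rewrite padic_redM; congr (_ * _); apply: padic_compat. Qed.
Definition padic_mul a b := Padic (padic_mul_subproof a b).

Fact padic_addA : associative padic_add.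
Proof. by move=> a b c; apply/padicP=> k; apply: addrA. Qed.
Fact padic_addC : commutative padic_add.
Proof. by move=> a b; apply/padicP=> k; apply: addrC. Qed.
Fact padic_add0 : left_id padic_zero padic_add.
Proof. by move=> a; apply/padicP=> k; apply: add0r. Qed.
Fact padic_addN : left_inverse padic_zero padic_opp padic_add.
Proof. by move=> a; apply/padicP=> k; apply: addNr. Qed.

HB.instance Definition _ := GRing.isZmodule.Build (padic p)
  padic_addA padic_addC padic_add0 padic_addN.

Fact padic_mulA : associative padic_mul.
Proof. by move=> a b c; apply/padicP=> k; apply: mulrA. Qed.
Fact padic_mulC : commutative padic_mul.
Proof. by move=> a b; apply/padicP=> k; apply: mulrC. Qed.
Fact padic_mul1 : left_id padic_one padic_mul.
Proof. by move=> a; apply/padicP=> k; apply: mul1r. Qed.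
Fact padic_mulDl : left_distributive padic_mul padic_add.
Proof. by move=> a b c; apply/padicP=> k; apply: mulrDl. Qed.
Fact padic_one_neq0 : padic_one != 0.
Proof.
apply/eqP=> /padicP/(_ 0)/eqP; apply/negP.
exact: (oner_neq0 'Z_(p ^ 1)).
Qed.

HB.instance Definition _ := GRing.Zmodule_isComNzRing.Build (padic p)
  padic_mulA padic_mulC padic_mul1 padic_mulDl padic_one_neq0.

Definition padic_unit : {pred padic p} := fun a => `[< exists b, b * a = 1 >].

Definition padic_inv (a : padic p) : padic p :=
  match pselect (exists b, b * a = 1) with
  | left ex_b => projT1 (cid ex_b)
  | right _ => a
  end.

Fact padic_mulV : {in padic_unit, left_inverse 1 padic_inv *%R}.
Proof.
move=> a /asboolP ex_b; rewrite /padic_inv.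
by case: pselect => // ex_b'; case: cid.
Qed.
Fact padic_unitPl (a b : padic p) : b * a = 1 -> padic_unit a.
Proof. by move=> ba1; apply/asboolP; exists b. Qed.
Fact padic_inv_out : {in [predC padic_unit], padic_inv =1 id}.
Proof.
move=> a /negP nUa; rewrite /padic_inv; case: pselect => // ex_b.
by case: nUa; apply/asboolP.
Qed.

HB.instance Definition _ := GRing.ComNzRing_hasMulInverse.Build (padic p)
  padic_mulV padic_unitPl padic_inv_out.

End PadicRing.

Definition padic_digit p (a : padic p) (i : nat) : nat :=
  (padic_val a i %/ p ^ i)%N.

Lemma ltn_padic_digit p (a : padic p) i : (1 < p)%N -> (padic_digit a i < p)%N.
Proof.
move=> p_gt1; rewrite ltn_divLR ?expn_gt0 ?(ltnW p_gt1) // -expnS.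
have := ltn_ord (padic_val a i).
by rewrite [X in (_ < X)%N -> _]Zp_cast // expn_gt1.
Qed.

(* The finite form of a = sum_(i >= 0) a_i p^i. *)
Lemma padic_digitE p (a : padic p) k : (1 < p)%N ->
  padic_val a k = (\sum_(i < k.+1) padic_digit a i * p ^ i)%N :> nat.
Proof.
move=> p_gt1; elim: k => [|k IHk].
  by rewrite big_ord_recr big_ord0 /= /padic_digit expn0 divn1 muln1.
rewrite big_ord_recr /= -IHk addnC -(padic_compat a k).
by rewrite val_Zp_nat ?expn_gt1 //; apply: divn_eq.
Qed.

Definition padic_mod p (a : padic p) : nat := padic_digit a 0.

Definition padic_congr p (k : nat) (m n : padic p) : Prop :=
  exists d : padic p, m - n = (p ^ k)%:R * d.

Definition in_residue p (r : nat) (n : padic p) : Prop :=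
  exists d : padic p, n = r%:R + p%:R * d.

Definition weakly_suitable p (r : nat) (f : padic p -> padic p) (k : nat) :=
  forall m n : padic p, in_residue r m -> in_residue r n ->
    padic_congr k m n ->
    padic_congr k (f m - (padic_mod (f m))%:R) (f n - (padic_mod (f n))%:R).

Definition suitable p (r : nat) (f : padic p -> padic p) (k : nat) :=
  forall m n : padic p, in_residue r m -> in_residue r n ->
    (padic_congr k m n <->
     padic_congr k (f m - (padic_mod (f m))%:R) (f n - (padic_mod (f n))%:R)).

(* Main.v *)
(* On [r + pZ_p] the first digit of [f] is a constant [c], and [f - c = G / h]
   with [G = g - c h] divisible by [p] and [h] invertible. By Taylor expansion,
   [G m - G n = (m - n) (G'(r) + p s)], and likewise [f m - f n] is, up to a
   unit, [(m - n) (G'(r) h(r) + p s)]. This gives (1), and (2) because any two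
   elements of [r + pZ_p] are congruent modulo [p]. For [k >= 2], both
   suitability conditions in (3) amount to [G'(r)] being a unit: if
   [q = gcd(p, u) > 1], then [u + p s] is divisible by [q], so that
   [r + p^(k-1) (p/q)] and [r] have the same image modulo [p^k]. *)
Require Import Defs.
From mathcomp Require Import all_boot all_order all_algebra.
From mathcomp Require Import ring.

Import GRing.Theory.
Local Open Scope ring_scope.

(** By Horner induction. With [m = r + c x] and [n = r + c y], the difference for [P * 'X + a] is
    [n (P m - P n) + c (x - y) P m]; the induction hypothesis at [(x, y)] handles the first term,
    and at [(x, 0)] it replaces [P m] by [P r] up to a multiple of [c]. *)
Lemma horner_sub_deriv (R : comNzRingType) (P : {poly R}) (r c x y : R) :
  exists s, P.[r + c * x] - P.[r + c * y] = c * (x - y) * (P^`().[r] + c * s).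
Proof.
elim/poly_ind: P x y => [|P a IHP] x y.
  by exists 0; rewrite deriv0 !horner0; ring.
have [s Ds] := IHP x y; have [t Dt] := IHP x 0.
move: Dt; rewrite mulr0 addr0 subr0 => /(canRL (subrK _)) Dt.
exists (x * (P^`().[r] + c * t) + r * s + y * (P^`().[r] + c * s)).
rewrite derivD derivM derivX derivC mulr1 addr0 !hornerE.
move: Ds => /(canRL (subrK _)) Ds.
have Dy : P.[r + c * y] =
    P.[r] + c * x * (P^`().[r] + c * t) - c * (x - y) * (P^`().[r] + c * s).
  by rewrite -[LHS](addKr (c * (x - y) * (P^`().[r] + c * s))) -Ds Dt; ring.
by rewrite Dy Dt; ring.
Qed.

Section PadicTheory.
Variable p : nat.
Hypothesis p_gt1 : (1 < p)%N.
Implicit Types (a b : padic p) (k : nat).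

Lemma padic_val_nat n k : padic_val (n%:R : padic p) k = n%:R.
Proof. by elim: n => // n IHn; rewrite !mulrSr -IHn. Qed.

Lemma padic_val_nat_eq0 n k :
  (padic_val (n%:R : padic p) k == 0) = (p ^ k.+1 %| n)%N.
Proof.
by rewrite padic_val_nat -val_eqE /= val_Zp_nat ?expn_gt1 //.
Qed.

Lemma padic_modE a : padic_mod a = padic_val a 0 :> nat.
Proof. by rewrite /padic_mod /padic_digit expn0 divn1. Qed.

Lemma ltn_padic_mod a : (padic_mod a < p)%N.
Proof. exact: ltn_padic_digit. Qed.

Lemma padic_mod_nat c : (c < p)%N -> padic_mod (c%:R : padic p) = c.
Proof.
move=> c_ltp; rewrite padic_modE padic_val_nat val_Zp_nat ?expn_gt1 //.
by rewrite expn1 modn_small.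
Qed.

Lemma padic_modDp a b : padic_mod (a + p%:R * b) = padic_mod a.
Proof.
rewrite !padic_modE; congr (nat_of_ord _).
rewrite -[LHS]/(padic_val a 0 + padic_val p%:R 0 * padic_val b 0).
suff /eqP-> : padic_val (p%:R : padic p) 0 == 0 by rewrite mul0r addr0.
by rewrite padic_val_nat_eq0 expn1.
Qed.

Lemma padic_val_modp a k : (padic_val a k = padic_mod a %[mod p])%N.
Proof.
elim: k => [|k IHk]; first by rewrite padic_modE.
rewrite -IHk -(padic_compat a k) val_Zp_nat ?expn_gt1 //.
by rewrite modn_dvdm // expnS dvdn_mulr.
Qed.

(** Dividing by [p] loses one digit, so component [k] of the quotient is read off component [k.+1]
    of [a]. These quotients are compatible because reducing [x] modulo [p^(k+2)] and then dividing
    by [p] is dividing first and reducing modulo [p^(k+1)]. *)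
Lemma padic_mod0 a : padic_mod a = 0 -> exists b, a = p%:R * b.
Proof.
move=> a0; pose d k : 'Z_(p ^ k.+1) := (padic_val a k.+1 %/ p)%:R.
have dvd_p k : (p %| padic_val a k)%N by rewrite /dvdn padic_val_modp a0 mod0n.
have d_compat k : (d k.+1)%:R = d k.
  rewrite /d; set x := padic_val a k.+2.
  rewrite -[LHS]/(padic_red _) padic_redE.
  apply: val_inj; rewrite /= !val_Zp_nat ?expn_gt1 //.
  rewrite -(padic_compat a k.+1) val_Zp_nat ?expn_gt1 // -/x.
  by rewrite [(p ^ k.+2)%N]expnSr -modn_divl modn_mod.
exists (Padic d_compat); apply/padicP => k.
rewrite -[RHS]/(padic_val p%:R k * d k) padic_val_nat /d -natrM.
by rewrite mulnC divnK // padic_compat.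
Qed.

Lemma padic_divmod a : exists b, a = (padic_mod a)%:R + p%:R * b.
Proof.
suff /padic_mod0[b Db] : padic_mod (a - (padic_mod a)%:R) = 0.
  by exists b; rewrite -Db addrC subrK.
rewrite padic_modE.
rewrite -[padic_val _ _]/(padic_val a 0 - padic_val (padic_mod a)%:R 0).
by rewrite padic_val_nat padic_modE natr_Zp subrr.
Qed.

(** All components of [a] agree modulo [p] with its first digit, so they are invertible as soon as
    that digit is coprime to [p]; uniqueness of inverses makes the componentwise inverses
    compatible. *)
Lemma padic_unitE a : (a \is a GRing.unit) = coprime p (padic_mod a).
Proof.
apply/idP/idP => [Ua|co_pa].
  suff : padic_val a 0 \is a GRing.unit.
    by rewrite -[padic_val a 0]natr_Zp unitZpE ?expn_gt1 // coprime_pexpl // -padic_modE.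
  apply/unitrPr; exists (padic_val a^-1 0).
  by rewrite -[LHS]/(padic_val (a * a^-1) 0) divrr.
have Uak k : padic_val a k \is a GRing.unit.
  rewrite -[padic_val a k]natr_Zp unitZpE ?expn_gt1 // coprimeXl //.
  by rewrite -coprime_modr padic_val_modp coprime_modr.
have inv_compat k : ((padic_val a k.+1)^-1)%:R = (padic_val a k)^-1.
  apply: (mulIr (Uak k)); rewrite mulVr ?Uak // -{1}(padic_compat a k).
  rewrite -[LHS]/(padic_red _ * padic_red _) -padic_redM mulVr ?Uak //.
apply/unitrP; exists (Padic inv_compat).
split; apply/padicP => k; first exact: (mulVr (Uak k)).
exact: (mulrV (Uak k)).
Qed.

Lemma padic_unitDp a b :
  (a + p%:R * b \is a GRing.unit) = (a \is a GRing.unit).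
Proof. by rewrite !padic_unitE padic_modDp. Qed.

Section Suitability.
Variables (r : nat) (F : padic p -> padic p) (u : padic p).
(** This is shared by the two functions of (3): [f], with [u = G'(r) h(r)] and [v = h m * h n], and
    [G], with [u = G'(r)] and [v = 1]. *)
Hypothesis F_diff : forall m n, in_residue r m -> in_residue r n ->
  exists v s, v \is a GRing.unit /\
  ((F m - (padic_mod (F m))%:R) - (F n - (padic_mod (F n))%:R)) * v
    = (m - n) * (u + p%:R * s).

Lemma weakly_suitable_diff k : weakly_suitable r F k.
Proof.
move=> m n rm rn [d Dd]; have [v [s [Uv]]] := F_diff _ _ rm rn.
rewrite Dd => /(canRL (mulrK Uv)) DF.
by exists (d * (u + p%:R * s) / v); rewrite DF !mulrA.
Qed.

Lemma suitable_diff k :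
  (2 <= k)%N -> suitable r F k <-> u \is a GRing.unit.
Proof.
case: k => [|[|k]] // _; split=> [Fk|Uu m n rm rn]; last first.
  split; first exact: weakly_suitable_diff.
  have [v [s [Uv DF]]] := F_diff _ _ rm rn; move=> [d Dd].
  have Us : u + p%:R * s \is a GRing.unit by rewrite padic_unitDp.
  exists (d * v / (u + p%:R * s)).
  by rewrite -[LHS](mulrK Us) -DF Dd !mulrA.
apply: contraT => nUu; pose q := gcdn p (padic_mod u).
have q_gt1 : (1 < q)%N.
  by rewrite ltn_neqAle eq_sym -[q == _]padic_unitE nUu gcdn_gt0 ltnW.
have Dp : ((p %/ q) * q = p)%N by rewrite divnK // dvdn_gcdl.
have [b Db] := padic_divmod u.
have [a Da] : exists a : nat, padic_mod u = (q * a)%N.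
  by exists (padic_mod u %/ q)%N; rewrite mulnC divnK // dvdn_gcdr.
(* The exponent in the definition of suitability is now [k.+2]. Thus [e] is a multiple of [p], which
   keeps [m] in the residue class, and [e * q] is [p ^ k.+2]. *)
pose e := (p ^ k.+1 * (p %/ q))%N; pose m : padic p := r%:R + e%:R.
have rn : in_residue r (r%:R : padic p) by exists 0; rewrite mulr0 addr0.
have rm : in_residue r m.
  by exists (p ^ k * (p %/ q))%:R; rewrite -natrM mulnA -expnS.
have Dm : m - r%:R = e%:R by rewrite /m addrC addKr.
have [v [s [Uv DF]]] := F_diff _ _ rm rn.
case: (Fk _ _ rm rn) => _ [].
  (* From [u = q a + p b] one gets [u + p s = q (a + (p/q) (b + s))], and this [q] completes [e] to
     [p ^ k.+2]. *)
  exists ((a%:R + (p %/ q)%:R * (b + s)) / v).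
  apply: (mulIr Uv); rewrite DF Dm mulrA mulrVK // {1}Db Da.
  have DpR : p%:R = (p %/ q)%:R * q%:R :> padic p by rewrite -natrM Dp.
  rewrite /e [(p ^ k.+2)%N]expnSr; move: (p ^ k.+1)%N => N.
  by rewrite !natrM DpR; ring.
move=> d; rewrite Dm => De.
(* Component [k.+1] lives modulo [p ^ k.+2], so its vanishing would force [p] to divide [p/q], which
   is positive and smaller than [p]. *)
have : padic_val (e%:R : padic p) k.+1 == 0.
  rewrite De -[padic_val _ _]/(padic_val (p ^ k.+2)%:R _ * padic_val d _).
  have /eqP-> : padic_val ((p ^ k.+2)%:R : padic p) k.+1 == 0.
    by rewrite padic_val_nat_eq0.
  by rewrite mul0r.
have p_gt0 := ltnW p_gt1.
rewrite padic_val_nat_eq0 /e expnSr dvdn_pmul2l ?expn_gt0 ?p_gt0 //.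
move=> /dvdn_leq; rewrite divn_gt0 ?(ltnW q_gt1) // dvdn_leq ?dvdn_gcdl //.
by move/(_ isT); rewrite leqNgt ltn_Pdiv.
Qed.

End Suitability.

End PadicTheory.

Theorem theorem4p16 (p r : nat) (f : padic p -> padic p)
    (g h : {poly (padic p)}) (k : nat)
    (p_ge2 : (2 <= p)%N) (r_ltp : (r < p)%N)
    (h_coprime : gcdn p (padic_mod h.[r%:R]) = 1%N)
    (f_eq : forall n : padic p, in_residue r n -> f n = g.[n] / h.[n]) :
  weakly_suitable r f k /\
  ((k <= 1)%N -> suitable r f k) /\
  ((2 <= k)%N ->
     (suitable r f k <->
      suitable r (horner (g - (padic_mod (f r%:R))%:R *: h)) k)).
Proof.
set c := padic_mod (f r%:R); set G := g - c%:R *: h.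
have Uhr : h.[r%:R] \is a GRing.unit.
  by rewrite padic_unitE //; apply/eqP.
have rr : in_residue r (r%:R : padic p) by exists 0; rewrite mulr0 addr0.
have diff (P : {poly padic p}) m n : in_residue r m -> in_residue r n ->
    exists s, P.[m] - P.[n] = (m - n) * (P^`().[r%:R] + p%:R * s).
  move=> [x ->] [y ->]; have [s ->] := horner_sub_deriv _ P r%:R p%:R x y.
  by exists s; ring.
have diff_r (P : {poly padic p}) n : in_residue r n ->
    exists s, P.[n] = P.[r%:R] + p%:R * s.
  move=> rn; have [s Ds] := diff P _ _ rn rr; case: rn Ds => x ->.
  move=> /(canRL (subrK _))->.
  exists (x * (P^`().[r%:R] + p%:R * s)); ring.
have Uh n : in_residue r n -> h.[n] \is a GRing.unit.
  by move=> /(diff_r h)[s ->]; rewrite padic_unitDp.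
have fE n : in_residue r n -> f n - c%:R = G.[n] / h.[n].
  move=> rn; apply: (mulIr (Uh n rn)); rewrite mulrVK ?Uh // f_eq //.
  by rewrite mulrBl mulrVK ?Uh // !hornerE.
have [z0 Dz0] : exists z, G.[r%:R] = p%:R * z.
  have [b Db] := padic_divmod p p_ge2 (f r%:R).
  exists (b * h.[r%:R]); rewrite -[LHS](mulrVK Uhr) -fE // {1}Db -/c.
  by rewrite addrC addKr mulrA.
have Gp n : in_residue r n -> exists z, G.[n] = p%:R * z.
  by move=> /(diff_r G)[s ->]; exists (z0 + s); rewrite Dz0 mulrDr.
have f_mod n : in_residue r n -> padic_mod (f n) = c.
  move=> rn; have [z Dz] := Gp n rn.
  rewrite -[f n](subrK c%:R) fE // Dz addrC -mulrA padic_modDp //.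
  by rewrite padic_mod_nat ?ltn_padic_mod.
have G_mod n : in_residue r n -> padic_mod G.[n] = 0.
  by move=> /Gp[z ->]; rewrite -[p%:R * z]add0r padic_modDp // (padic_mod_nat _ _ 0).
have f_diff m n : in_residue r m -> in_residue r n ->
    exists v s, v \is a GRing.unit /\
    ((f m - (padic_mod (f m))%:R) - (f n - (padic_mod (f n))%:R)) * v
      = (m - n) * (G^`().[r%:R] * h.[r%:R] + p%:R * s).
  move=> rm rn; rewrite !f_mod // !fE //.
  have [s Ds] := diff G _ _ rm rn; have [t Dt] := diff h _ _ rm rn.
  have [z Dz] := Gp n rn; have [y Dy] := diff_r h n rn.
  (* Clearing denominators leaves [(G m - G n) h n - G n (h m - h n)]. Since [h n = h r + p y] and
     [G n = p z], everything except [(m - n) G'(r) h(r)] is [(m - n)] times a multiple of [p]. *)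
  exists (h.[m] * h.[n]).
  exists (s * h.[r%:R] + (G^`().[r%:R] + p%:R * s) * y
           - z * (h^`().[r%:R] + p%:R * t)).
  split; first by rewrite unitrM !Uh.
  have -> : (G.[m] / h.[m] - G.[n] / h.[n]) * (h.[m] * h.[n]) =
      (G.[m] - G.[n]) * h.[n] - G.[n] * (h.[m] - h.[n]).
    transitivity (G.[m] * h.[n] * (h.[m]^-1 * h.[m])
                  - G.[n] * h.[m] * (h.[n]^-1 * h.[n])); first by ring.
    by rewrite !mulVr ?Uh //; ring.
  by rewrite Ds Dt Dz Dy; ring.
have G_diff m n : in_residue r m -> in_residue r n ->
    exists v s, v \is a GRing.unit /\
    ((G.[m] - (padic_mod G.[m])%:R) - (G.[n] - (padic_mod G.[n])%:R)) * v
      = (m - n) * (G^`().[r%:R] + p%:R * s).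
  move=> rm rn; rewrite !G_mod // !subr0; have [s ->] := diff G _ _ rm rn.
  by exists 1, s; rewrite unitr1 mulr1.
have f_weak := weakly_suitable_diff _ _ _ _ f_diff.
split; [exact: f_weak | split=> [k_le1|k_ge2]].
  move=> m n rm rn; split=> [|_]; first exact: f_weak.
  case: rm rn => x -> [y ->]; case: k k_le1 => [|[]] // _.
    by exists (p%:R * (x - y)); rewrite expn0; ring.
  by exists (x - y); rewrite expn1; ring.
(* As [h r] is a unit, [G'(r) h(r)] is a unit exactly when [G'(r)] is. *)
have := suitable_diff _ p_ge2 _ _ _ f_diff _ k_ge2; rewrite unitrM Uhr andbT.
by have := suitable_diff _ p_ge2 _ _ _ G_diff _ k_ge2; tauto.
Qed.
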